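(* As $n\to\infty$ (through the positive integers): (i) $\gamma^{(n)}=n!\left(1-\dfrac{1}{2^{n+1}}+O\left(\dfrac{1}{3^n}\right)\right)$; (ii) $\left|\delta^{(n)}\right|=e\left[W(n)\right]^n\exp\left(-\dfrac{n}{W(n)}\right)\sqrt{\dfrac{2\pi n}{W(n)+1}}\,\left(1+o(1)\right)$, where $W(n)$ denotes the principal branch of the Lambert W function for $n>0$; and (iii) $\eta^{(n)}=n!\left(1-\dfrac{1}{2^{n+1}}+O\left(\dfrac{1}{3^n}\right)\right)$.
   Context: For integers $n\ge 0$, define $$\gamma^{(n)}=\int_{-\infty}^{\infty}x^n\exp\left(-x-e^{-x}\right)dx=(-1)^n\Gamma^{(n)}(1),\qquad \delta^{(n)}=-e\int_{-\infty}^{0}x^n\exp\left(-x-e^{-x}\right)dx,\qquad \eta^{(n)}=-n!\sum_{k=1}^{\infty}\frac{(-1)^k}{k^n\cdot k!},$$ the generalized Euler-Mascheroni, Euler-Gompertz, and Eta constants, respectively, where $\Gamma^{(n)}(1)$ is the $n$-th derivative of the Gamma function at $1$. For $n>0$, $W(n)$ is the unique positive real number with $W(n)e^{W(n)}=n$. *)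

(* Defs.v *)
From HB Require Import structures.
From mathcomp Require Import all_boot all_order all_algebra.
From mathcomp Require Import all_classical all_reals all_analysis.

Set Implicit Arguments.
Unset Strict Implicit.
Unset Printing Implicit Defensive.

Import Order.TTheory GRing.Theory Num.Theory.
Import numFieldNormedType.Exports.

Local Open Scope classical_set_scope.
Local Open Scope ring_scope.

(* The integrals below are Lebesgue integrals over unbounded intervals; the
   integrands are absolutely integrable, so they agree with the improper
   Riemann integrals. *)

Definition euler_mascheroni (R : realType) (n : nat) : R :=
  \int[lebesgue_measure]_x (x ^+ n * expR (- x - expR (- x))).

Definition euler_gompertz (R : realType) (n : nat) : R :=
  - expR 1 *
  \int[lebesgue_measure]_(x in `]-oo, 0]) (x ^+ n * expR (- x - expR (- x))).

Definition eta_const (R : realType) (n : nat) : R :=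
  - (n`!)%:R *
  limn (fun N : nat =>
    \sum_(1 <= k < N) ((-1) ^+ k / (k%:R ^+ n * (k`!)%:R) : R)).

(* The positive solution w of w * e^w = x: it exists and is unique for x > 0,
   and the default value 0 is only returned for x <= 0. *)
Definition lambertW (R : realType) (x : R) : R :=
  xget 0 [set w : R | 0 < w /\ w * expR w = x].

(* Main.v *)
Require Import Defs.
From HB Require Import structures.
From mathcomp Require Import all_boot all_order all_algebra.
From mathcomp Require Import all_classical all_reals all_analysis.
From mathcomp Require Import ring lra measurable_realfun.

Import Order.TTheory GRing.Theory Num.Theory.
Import numFieldNormedType.Exports.

Local Open Scope classical_set_scope.
Local Open Scope ring_scope.

(* For (i), the integrand over [0, +oo[ is x^n e^{-x} exp(-t) with t = e^{-x}
   in [0, 1]; exp(-t) = 1 - t + O(t^2) and the moments of x^n e^{-ax} give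
   n!(1 - 2^{-n-1} + O(3^{-n})), while the part over ]-oo, 0] is O(n!/3^n)
   because y - e^y <= 8 - 3y.
   For (ii), |delta^(n)| / e is the integral over [0, +oo[ of y^n exp(y - e^y).
   With W = W(n), so that n = W e^W, put y = W + s u with
   s^2 = W / ((W + 1) e^W); after division by the value at y = W the integrand
   converges pointwise to exp(-u^2/2) and is eventually dominated by
   exp(4 - |u|/2), so dominated convergence gives the factor sqrt(2 pi).
   For (iii), the terms k >= 3 of the series are at most 3^{-n} / k!. *)

(** * Moments of x^n e^{-ax} over the half-line *)

Section exponential_moments.
Context {R : realType}.
Implicit Types (a x : R) (n : nat).
Local Notation mu := (@lebesgue_measure R).

(** Antiderivative of x^n e^{-ax}, built by the recursion that integration by parts gives. *)
Fixpoint powexp_primitive a n x : R :=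
  if n is m.+1 then
    - a^-1 * (x ^+ m.+1 * expR (- a * x)) + m.+1%:R / a * powexp_primitive a m x
  else - a^-1 * expR (- a * x).

Lemma is_derive_expRMl a x :
  is_derive x 1 (fun y : R => expR (a * y)) (a * expR (a * x)).
Proof.
have h : is_derive x 1 (a *: (@id R)) a.
  by apply: is_derive_eq; rewrite /GRing.scale/= mulr1.
have := @is_derive1_comp R expR (a *: id) x _ _ (is_derive_expR _) h.
by rewrite mulrC.
Qed.

Lemma is_derive_powexp_primitive a n x : a != 0 ->
  is_derive x 1 (powexp_primitive a n) (x ^+ n * expR (- a * x)).
Proof.
move=> a0; have h := is_derive_expRMl (- a) x.
elim: n => [|n ih].
  rewrite (_ : powexp_primitive a 0 =
    (- a^-1) *: (fun y : R => expR (- a * y))); last exact/funext.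
  apply: is_derive_eq; rewrite /GRing.scale/= expr0.
  by field.
rewrite (_ : powexp_primitive a n.+1 =
    (- a^-1) *: ((id ^+ n.+1) * (fun y : R => expR (- a * y))) +
    (n.+1%:R / a) *: powexp_primitive a n); last first.
  by apply/funext => y; rewrite /= !fctE.
apply: is_derive_eq; rewrite /GRing.scale/= !fctE /= mulr1 exprS.
by field.
Qed.

Lemma powexp_primitive0 a n : powexp_primitive a n 0 = - (n`!%:R / a ^+ n.+1).
Proof.
elim: n => [|n ih] /=; first by rewrite mulr0 expR0 mulr1 expr1 mul1r.
rewrite ih expr0n/= mul0r mulr0 add0r mulrN; congr -%R.
by rewrite factS natrM (exprS a n.+1) invfM; ring.
Qed.

(** The single Taylor term (ax)^{n+1} / (n+1)! of e^{ax} already bounds the function by a constant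
    times 1/x. *)
Lemma cvg_powexp a n : 0 < a -> x ^+ n * expR (- a * x) @[x --> +oo] --> 0.
Proof.
move=> a0.
apply: (@squeeze_cvgr _ _ _ _ (cst 0)
  (fun x => (n.+1)`!%:R / a ^+ n.+1 * x^-1)); last 2 first.
- exact: cvg_cst.
- rewrite -[X in _ --> X](mulr0 ((n.+1)`!%:R / a ^+ n.+1)).
  apply: cvgM; first exact: cvg_cst.
  apply/gtr0_cvgV0; last exact: cvg_id.
  by near=> x; near: x; exact: nbhs_pinfty_gt.
near=> x.
have x0 : 0 < x by near: x; exact: nbhs_pinfty_gt.
apply/andP; split; first by rewrite mulr_ge0 ?exprn_ge0 ?expR_ge0 ?ltW.
rewrite /= mulNr expRN ler_pdivrMr ?expR_gt0//.
have := @expR_ge1Dxn R (a * x) n (ltW (mulr_gt0 a0 x0)) => he.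
have : (a * x) ^+ n.+1 / n.+1`!%:R <= expR (a * x).
  by apply: le_trans he; rewrite lerDr.
have f0 : 0 < n.+1`!%:R :> R by rewrite ltr0n fact_gt0.
move=> /(ler_wpM2l (_ : 0 <= n.+1`!%:R / a ^+ n.+1 * x^-1)) => h.
apply: le_trans (h _); last first.
  by rewrite ltW// mulr_gt0 ?divr_gt0 ?invr_gt0 ?exprn_gt0.
rewrite le_eqVlt; apply/orP; left; apply/eqP.
rewrite exprMn (exprS x); move: f0 (exprn_gt0 n.+1 a0).
move: (n.+1`!%:R) (a ^+ n.+1) => c d c0 d0.
by field; rewrite ?gt_eqF.
Unshelve. all: by end_near. Qed.

Lemma cvg_powexp_primitive a n : 0 < a ->
  powexp_primitive a n x @[x --> +oo] --> 0.
Proof.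
move=> a0; elim: n => [|n ih] /=.
  rewrite -(mulr0 (- a^-1)); apply: cvgM; first exact: cvg_cst.
  by have := cvg_powexp a 0 a0; under eq_fun do rewrite expr0 mul1r.
rewrite [X in _ --> X](_ : _ = - a^-1 * 0 + n.+1%:R / a * 0); last by ring.
apply: cvgD; apply: cvgM => //; try exact: cvg_cst.
exact: cvg_powexp.
Qed.

Lemma continuous_expRMl a : continuous (fun x => expR (a * x)).
Proof.
move=> x; apply/differentiable_continuous/derivable1_diffP.
by have [] := is_derive_expRMl a x.
Qed.

Lemma continuous_powexp a n : continuous (fun x => x ^+ n * expR (a * x)).
Proof.
move=> x; apply: cvgM; first exact: exprn_continuous.
exact: continuous_expRMl.
Qed.

Lemma integral_powexp a n : 0 < a ->
  (\int[mu]_(x in `[0%R, +oo[) (x ^+ n * expR (- a * x))%:E =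
   (n`!%:R / a ^+ n.+1)%:E)%E.
Proof.
move=> a0; have a1 : a != 0 by rewrite gt_eqF.
have dF x : is_derive x 1 (powexp_primitive a n) (x ^+ n * expR (- a * x)).
  exact: is_derive_powexp_primitive.
rewrite (@ge0_continuous_FTC2y R _ (powexp_primitive a n) 0 0).
- by rewrite powexp_primitive0 EFinN oppeK add0e.
- by move=> x x0; rewrite mulr_ge0 ?exprn_ge0 ?expR_ge0.
- exact/continuous_subspaceT/continuous_powexp.
- exact: cvg_powexp_primitive.
- by move=> x _; have [] := dF x.
- apply: cvg_at_right_filter; apply/differentiable_continuous/derivable1_diffP.
  by have [] := dF 0.
- by move=> x _; rewrite derive1E derive_val.
Qed.

Lemma measurable_fun_powexp a n (D : set R) :
  measurable_fun D (fun x => x ^+ n * expR (a * x)).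
Proof.
apply: measurable_funTS; apply: continuous_measurable_fun.
exact: continuous_powexp.
Qed.

Lemma integrable_powexp a n : 0 < a ->
  mu.-integrable `[0, +oo[ (fun x => (x ^+ n * expR (- a * x))%:E).
Proof.
move=> a0; apply/integrableP; split.
  by apply/measurable_EFinP; exact: measurable_fun_powexp.
under eq_integral => x.
  rewrite inE/= in_itv/= andbT => x0.
  rewrite ger0_norm ?mulr_ge0 ?exprn_ge0 ?expR_ge0//; over.
by rewrite integral_powexp// ltry.
Qed.

End exponential_moments.

(** * Series dominated by c / k!, Taylor remainders of exp, and the Eta constants *)

Section factorial_series.
Context {R : realType}.
Implicit Types (a : R^nat) (c x s : R).

Lemma limn_series_fact_le a c : (forall k, `|a k| <= c / k`!%:R) ->
  cvgn (series a) /\ `|limn (series a)| <= c * expR 1.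
Proof.
move=> ac.
have ce k : c / k`!%:R = c *: exp_coeff 1 k.
  by rewrite /exp_coeff/= expr1n div1r.
have cve : cvgn (series (fun k => c *: exp_coeff 1 k)).
  by apply: is_cvg_seriesZ; exact: is_cvg_series_exp_coeff.
have le_ac k : `|a k| <= c *: exp_coeff 1 k by rewrite -ce.
have cva : cvgn [normed series a].
  apply: series_le_cvg cve => k //.
- exact: normr_ge0.
- exact: le_trans (normr_ge0 _) (le_ac k).
- exact: le_ac.
split; first exact: normed_cvg.
apply: le_trans (lim_series_norm cva) _.
apply: le_trans (lim_series_le cva cve le_ac) _.
by rewrite lim_seriesZ//; exact: is_cvg_series_exp_coeff.
Qed.

(** Common tool for the Taylor remainders of exp and for the Eta series. Since (k + m)! >= k!, the
    tail from index m is dominated by c times the exponential series at 1. *)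
Lemma cvg_series_fact a c m : (forall k, (m <= k)%N -> `|a k| <= c / k`!%:R) ->
  exists2 l, series a @ \oo --> l &
    `|l - \sum_(0 <= k < m) a k| <= c * expR 1.
Proof.
move=> ac.
have c0 : 0 <= c.
  have : 0 <= c / m`!%:R by exact: le_trans (normr_ge0 _) (ac m (leqnn m)).
  by rewrite pmulr_lge0// invr_gt0 ltr0n fact_gt0.
have [|cb blec] := limn_series_fact_le (fun k => a (k + m)%N) c.
  move=> k; apply: le_trans (ac _ (leq_addl _ _)) _.
  rewrite ler_wpM2l// lef_pV2 ?posrE ?ltr0n ?fact_gt0//.
  by rewrite ler_nat leq_fact// leq_addr.
exists (\sum_(0 <= k < m) a k + limn (series (fun k => a (k + m)%N))).
  rewrite -(cvg_shiftn m).
  rewrite (_ : [sequence series a (n + m)%N]_n =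
    (fun n => \sum_(0 <= k < m) a k + series (fun k => a (k + m)%N) n)).
    by apply: cvgD => //; exact: cvg_cst.
  apply/funext => n; rewrite /series/= (@big_cat_nat _ _ _ m)/= ?leq_addl//.
  by congr (_ + _); rewrite -{1}(add0n m) big_addn addnK.
by rewrite addrAC subrr add0r.
Qed.

(** For |s| <= 1 the powers |s|^k with k >= 2 are at most s^2, so the tail of the exponential series
    fits [cvg_series_fact]. *)
Lemma normr_expR_sub_le s : `|s| <= 1 ->
  `|expR s - (1 + s)| <= expR 1 * s ^+ 2.
Proof.
move=> s1.
have [|l ls] := @cvg_series_fact (exp_coeff s) (s ^+ 2) 2.
  move=> k k2; rewrite /exp_coeff/= normrM normrX.
  rewrite normfV (ger0_norm (ler0n _ _)) ler_pM2r ?invr_gt0 ?ltr0n ?fact_gt0//.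
  by rewrite -(real_normK (num_real s)) ler_wiXn2l.
rewrite (_ : l = expR s); last by rewrite /expR; apply/esym/cvg_lim.
rewrite big_nat_recr//= big_nat1 /exp_coeff/= expr0 expr1 !fact0 divr1.
by rewrite (_ : 1`! = 1%N)// divr1 mulrC.
Qed.

Lemma normr_expR_sub2_le s : `|s| <= 1 ->
  `|expR s - (1 + s + s ^+ 2 / 2)| <= expR 1 * `|s| ^+ 3.
Proof.
move=> s1.
have [|l ls] := @cvg_series_fact (exp_coeff s) (`|s| ^+ 3) 3.
  move=> k k2; rewrite /exp_coeff/= normrM normrX.
  rewrite normfV (ger0_norm (ler0n _ _)) ler_pM2r ?invr_gt0 ?ltr0n ?fact_gt0//.
  by rewrite ler_wiXn2l.
rewrite (_ : l = expR s); last by rewrite /expR; apply/esym/cvg_lim.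
rewrite !big_nat_recr//= big_nil add0r /exp_coeff/= expr0 expr1 !fact0 divr1.
by rewrite (_ : 1`! = 1%N)// (_ : 2`! = 2%N)// divr1 (mulrC _ (expR 1)).
Qed.

Lemma eta_const_bound n : (0 < n)%N ->
  `|eta_const R n / n`!%:R - (1 - 1 / 2 ^+ n.+1)| <= expR 1 * (1 / 3 ^+ n).
Proof.
move=> n0.
pose a k : R := (-1) ^+ k / (k%:R ^+ n * k`!%:R).
(* The cut is at 3 because the terms of index 1 and 2 are -1 and 1 / 2^{n+1}, which form the main
   part up to sign. *)
have [|l al] := @cvg_series_fact a (1 / 3 ^+ n) 3.
  move=> k k3; rewrite /a normrM normrX normrN1 expr1n mul1r.
  have k0 : 0 < k%:R :> R by rewrite ltr0n (leq_trans _ k3).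
  rewrite normfV ger0_norm ?mulr_ge0 ?exprn_ge0 ?ler0n// invfM !mul1r.
  rewrite ler_wpM2r ?invr_ge0 ?ler0n//.
  rewrite lef_pV2 ?posrE ?exprn_gt0// ?ltr0n//.
  by rewrite lerXn2r ?nnegrE ?ler0n// ler_nat.
rewrite /eta_const (_ : limn _ = l); last first.
  apply/cvg_lim => //.
  rewrite (_ : (fun N => _) = series a)//.
  apply/funext => -[|N]; rewrite /series/=; first by rewrite !big_geq.
  (* the term of index 0 vanishes since 1 / 0 = 0 *)
  rewrite [RHS]big_ltn// [a 0]/a expr0n gtn_eqF//= mul0r invr0 mulr0 add0r.
  exact: eq_bigr.
rewrite !big_nat_recr//= big_nil add0r.
rewrite /a expr0n gtn_eqF//= mul0r invr0 mulr0 add0r expr1 expr1n sqrrN expr1n.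
rewrite (_ : 1`! = 1%N)// (_ : 2`! = 2%N)// mul1r divr1 -exprSr => ln.
have f0 : n`!%:R != 0 :> R by rewrite pnatr_eq0 gtn_eqF ?fact_gt0.
have -> : - n`!%:R * l / n`!%:R = - l.
  by move: (n`!%:R) f0 => c c0; field.
by rewrite -normrN mulrC; move: ln; congr (`| _ | <= _); ring.
Qed.

End factorial_series.

(** * Moments of exp(-x - e^{-x}) on the two half-lines, and the Euler-Mascheroni constants *)

Section gumbel_moments.
Context {R : realType}.
Implicit Types (a x y : R) (n : nat).
Local Notation mu := (@lebesgue_measure R).

Lemma le_integrable_EFin (D : set R) (f g : R -> R) :
  measurable D -> measurable_fun D f -> (forall x, D x -> `|f x| <= g x) ->
  mu.-integrable D (EFin \o g) -> mu.-integrable D (EFin \o f).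
Proof.
move=> mD mf fg; apply: le_integrable => //; first exact/measurable_EFinP.
by move=> x Dx /=; rewrite lee_fin; apply: le_trans (fg x Dx) (ler_norm _).
Qed.

Lemma integrable_EFinZl (D : set R) (f : R -> R) (k : R) :
  measurable D -> mu.-integrable D (EFin \o f) ->
  mu.-integrable D (EFin \o (fun x => k * f x)).
Proof.
by move=> mD fi; exact: (@integrableZl _ _ R mu D mD k (EFin \o f) fi).
Qed.

Lemma integrable_EFinB (D : set R) (f g : R -> R) :
  measurable D -> mu.-integrable D (EFin \o f) ->
  mu.-integrable D (EFin \o g) ->
  mu.-integrable D (EFin \o (fun x => f x - g x)).
Proof.
move=> mD fi gi.
exact: (@integrableB _ _ R mu D mD (EFin \o f) (EFin \o g) fi gi).
Qed.

Lemma Rintegral_powexp a n : 0 < a ->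
  \int[mu]_(x in `[0, +oo[) (x ^+ n * expR (- a * x)) = n`!%:R / a ^+ n.+1.
Proof. by move=> a0; rewrite /Rintegral integral_powexp. Qed.

Lemma continuous_gompertz n : continuous (fun y => y ^+ n * expR (y - expR y)).
Proof.
move=> y; apply: cvgM; first exact: exprn_continuous.
apply: continuous_comp; last exact: continuous_expR.
by apply: cvgB; [exact: cvg_id | exact: continuous_expR].
Qed.

Lemma continuous_gumbel n :
  continuous (fun x => x ^+ n * expR (- x - expR (- x))).
Proof.
move=> x; apply: cvgM; first exact: exprn_continuous.
apply: (continuous_comp (f := -%R) (g := fun y => expR (y - expR y))).
  exact: oppr_continuous.
by have := continuous_gompertz 0 (- x); under eq_fun do rewrite expr0 mul1r.
Qed.

(** Squaring e^{y/2} >= 1 + y/2 gives y - e^y <= -1 - y^2/4, and 8 - 3y exceeds the right side by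
    (y/2 - 3)^2. The rate 3 is the one that produces errors of order n! / 3^n. *)
Lemma gompertz_le y : 0 <= y -> expR (y - expR y) <= expR 8 * expR (- 3 * y).
Proof.
move=> y0; rewrite -expRD ler_expR.
suff : 1 + y + y ^+ 2 / 4 <= expR y.
  have := sqr_ge0 (y / 2 - 3); nra.
have -> : expR y = expR (y / 2) ^+ 2 by rewrite -expRM_natl mulrC divfK.
have := expR_ge1Dx (y / 2); have := expR_ge0 (y / 2); nra.
Qed.

Lemma integrable_gompertz n :
  mu.-integrable `[0, +oo[ (fun y => (y ^+ n * expR (y - expR y))%:E).
Proof.
apply: (le_integrable_EFin _ _ (fun y => expR 8 * (y ^+ n * expR (- 3 * y)))).
- by [].
- apply: measurable_funTS; apply: continuous_measurable_fun.
  exact: continuous_gompertz.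
- move=> y /=; rewrite in_itv/= andbT => y0.
  rewrite !ger0_norm ?mulr_ge0 ?exprn_ge0 ?expR_ge0//.
  by rewrite mulrCA ler_wpM2l ?exprn_ge0 ?gompertz_le.
- by apply: integrable_EFinZl => //; exact: integrable_powexp.
Qed.

(** The contribution of ]-oo, 0], reflected by y = -x and stripped of its sign. It is an error term
    for the Euler-Mascheroni constants and the whole of the Euler-Gompertz ones, up to the factor
    e. *)
Definition gompertz_moment n : R :=
  \int[mu]_(y in `[0, +oo[) (y ^+ n * expR (y - expR y)).

Lemma gompertz_moment_ge0 n : 0 <= gompertz_moment n.
Proof.
apply: Rintegral_ge0 => y /=; rewrite in_itv/= andbT => y0.
by rewrite mulr_ge0 ?exprn_ge0 ?expR_ge0.
Qed.

Lemma gompertz_moment_le n : gompertz_moment n <= expR 8 * (n`!%:R / 3 ^+ n.+1).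
Proof.
have ie : mu.-integrable `[0, +oo[ (EFin \o (fun y => y ^+ n * expR (- 3 * y))).
  exact: integrable_powexp.
rewrite -Rintegral_powexp// -RintegralZl//.
apply: le_Rintegral => //.
- exact: integrable_gompertz.
- exact: integrable_EFinZl.
- move=> y /=; rewrite in_itv/= andbT => y0.
  by rewrite mulrCA ler_wpM2l ?exprn_ge0 ?gompertz_le.
Qed.

Let gumbel_reflected n x : (- x) ^+ n * expR (- x - expR (- x)) =
  (-1) ^+ n * (x ^+ n * expR (- x - expR (- x))).
Proof. by rewrite mulrA -exprMn mulN1r. Qed.

(** Stated with (- x)^n so that the integrand is nonnegative on ]-oo, 0], as the change of variables
    x = -y requires. *)
Lemma integral_gumbel_Ny0 n :
  (\int[mu]_(x in `]-oo, 0%R]) ((- x) ^+ n * expR (- x - expR (- x)))%:E =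
   (gompertz_moment n)%:E)%E.
Proof.
rewrite -{1}oppr0 (@ge0_integration_by_substitutionNy R
  (fun x => (- x) ^+ n * expR (- x - expR (- x))) 0).
- under eq_integral do rewrite /= opprK.
  rewrite /gompertz_moment /Rintegral fineK//.
  by apply: integrable_fin_num => //; exact: integrable_gompertz.
- apply: continuous_subspaceT => x.
  apply: (continuous_comp (f := -%R)
    (g := fun y => y ^+ n * expR (y - expR y))).
    exact: oppr_continuous.
  exact: continuous_gompertz.
- move=> x; rewrite in_itv/= oppr0 => x0.
  by rewrite mulr_ge0 ?exprn_ge0 ?expR_ge0// oppr_ge0 ltW.
Qed.

Lemma integrable_gumbel_Ny0 n :
  mu.-integrable `]-oo, 0] (fun x => (x ^+ n * expR (- x - expR (- x)))%:E).
Proof.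
apply/integrableP; split.
  apply/measurable_EFinP/measurable_funTS; apply: continuous_measurable_fun.
  exact: continuous_gumbel.
under eq_integral => x.
  rewrite inE/= in_itv/= => x0.
  rewrite normrM (ger0_norm (expR_ge0 _)) normrX ler0_norm//; over.
by rewrite integral_gumbel_Ny0 ltry.
Qed.

Lemma Rintegral_gumbel_Ny0 n :
  \int[mu]_(x in `]-oo, 0]) (x ^+ n * expR (- x - expR (- x))) =
  (-1) ^+ n * gompertz_moment n.
Proof.
have -> : gompertz_moment n =
    \int[mu]_(x in `]-oo, 0]) ((- x) ^+ n * expR (- x - expR (- x))).
  by rewrite /Rintegral integral_gumbel_Ny0.
under [in RHS]eq_Rintegral do rewrite gumbel_reflected.
rewrite RintegralZl//; last exact: integrable_gumbel_Ny0.
by rewrite mulrA -exprMn mulrNN mul1r expr1n mul1r.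
Qed.

Lemma normr_euler_gompertz n :
  `|euler_gompertz R n| = expR 1 * gompertz_moment n.
Proof.
rewrite /euler_gompertz Rintegral_gumbel_Ny0 !normrM normrN normrX normrN1.
by rewrite expr1n mul1r !ger0_norm ?expR_ge0 ?gompertz_moment_ge0.
Qed.

Lemma gumbel_expansion x n : 0 <= x ->
  `|x ^+ n * expR (- x - expR (- x)) -
    (x ^+ n * expR (- 1 * x) - x ^+ n * expR (- 2 * x))| <=
  expR 1 * (x ^+ n * expR (- 3 * x)).
Proof.
move=> x0.
have -> : - 1 * x = - x by ring.
have -> : - 2 * x = - x - x by ring.
have -> : - 3 * x = - x - x - x by ring.
(* In terms of t, the difference is x^n t (e^{-t} - (1 - t)); the factor t turns the quadratic
   Taylor error into t^3 = e^{-3x}. *)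
rewrite !expRD; set t := expR (- x).
have t0 : 0 <= t by exact: expR_ge0.
have t1 : t <= 1 by rewrite /t expR_le1 oppr_le0.
have : `|expR (- t) - (1 + - t)| <= expR 1 * (- t) ^+ 2.
  by apply: normr_expR_sub_le; rewrite normrN ger0_norm.
move=> /(ler_wpM2l (mulr_ge0 (exprn_ge0 n x0) t0)).
rewrite -{1}(ger0_norm (mulr_ge0 (exprn_ge0 n x0) t0)) -normrM.
by congr (`| _ | <= _); ring.
Qed.

Lemma integrable_gumbel_0y n :
  mu.-integrable `[0, +oo[ (fun x => (x ^+ n * expR (- x - expR (- x)))%:E).
Proof.
apply: (le_integrable_EFin _ _ (fun y => y ^+ n * expR (- 1 * y))).
- by [].
- apply: measurable_funTS; apply: continuous_measurable_fun.
  exact: continuous_gumbel.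
- move=> y /=; rewrite in_itv/= andbT => y0.
  rewrite !ger0_norm ?mulr_ge0 ?exprn_ge0 ?expR_ge0//.
  rewrite ler_wpM2l ?exprn_ge0// ler_expR mulN1r.
  by rewrite gerDl oppr_le0 expR_ge0.
- exact: integrable_powexp.
Qed.

Lemma gumbel_moment_0y n :
  `|\int[mu]_(x in `[0, +oo[) (x ^+ n * expR (- x - expR (- x))) -
    n`!%:R * (1 - 1 / 2 ^+ n.+1)| <= expR 1 * (n`!%:R / 3 ^+ n.+1).
Proof.
have i1 := integrable_powexp (1 : R) n ltr01.
have i2 := integrable_powexp (2 : R) n (ltr0n _ 2).
have i3 := integrable_powexp (3 : R) n (ltr0n _ 3).
have i12 : mu.-integrable `[0, +oo[ (EFin \o
  (fun x => x ^+ n * expR (- 1 * x) - x ^+ n * expR (- 2 * x))).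
  exact: integrable_EFinB.
have ig := integrable_gumbel_0y n.
rewrite (_ : n`!%:R * _ = \int[mu]_(x in `[0, +oo[)
   (x ^+ n * expR (- 1 * x) - x ^+ n * expR (- 2 * x))); last first.
  by rewrite RintegralB// !Rintegral_powexp// expr1n mulrBr mulr1 divr1 mul1r.
rewrite -RintegralB//.
have id : mu.-integrable `[0, +oo[ (EFin \o
    (fun x => x ^+ n * expR (- x - expR (- x)) -
  (x ^+ n * expR (- 1 * x) - x ^+ n * expR (- 2 * x)))).
  exact: integrable_EFinB.
apply: le_trans (le_normr_Rintegral _ id) _ => //.
rewrite -Rintegral_powexp// -RintegralZl//.
apply: le_Rintegral => //.
- exact: (integrable_norm id).
- exact: integrable_EFinZl.
- by move=> x /=; rewrite in_itv/= andbT => /gumbel_expansion.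
Qed.

Lemma euler_mascheroni_split n : euler_mascheroni R n =
  \int[mu]_(x in `[0, +oo[) (x ^+ n * expR (- x - expR (- x))) +
  (-1) ^+ n * gompertz_moment n.
Proof.
have iN := integrable_gumbel_Ny0 n.
rewrite /euler_mascheroni -Rintegral_gumbel_Ny0.
(* Dropping the endpoint 0 makes the two half-lines disjoint. *)
rewrite -Rintegral_itv_bndo_bndc; last first.
  apply: integrableS iN => //.
  by move=> x /=; rewrite !in_itv/=; exact: ltW.
have dN : [disjoint `]-oo, (0:R)[%classic & `[(0:R), +oo[%classic].
  rewrite disj_set2E; apply/eqP; rewrite -subset0 => x /=.
  by rewrite !in_itv/= andbT => -[]; rewrite ltNge => /negP.
have iN' : mu.-integrable `]-oo, 0[
    (fun x => (x ^+ n * expR (- x - expR (- x)))%:E).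
  apply: integrableS iN => //.
  by move=> x /=; rewrite !in_itv/=; exact: ltW.
rewrite -{1}(setvU `[(0:R), +oo[) setCitvr addrC Rintegral_setU//.
have mf : measurable_fun setT (fun x : R => x ^+ n * expR (- x - expR (- x))).
  by apply: continuous_measurable_fun; exact: continuous_gumbel.
apply/integrableP; split; first exact/measurable_EFinP/measurable_funTS.
rewrite ge0_integral_setU//=; last first.
  by apply/measurable_EFinP/measurable_funTS; exact: measurableT_comp.
by apply: lte_add_pinfty; [have /integrableP[] := iN'
  | have /integrableP[] := integrable_gumbel_0y n].
Qed.

Lemma euler_mascheroni_bound n :
  `|euler_mascheroni R n / n`!%:R - (1 - 1 / 2 ^+ n.+1)| <=
  (expR 1 + expR 8) / 3 * (1 / 3 ^+ n).
Proof.
have f0 : 0 < n`!%:R :> R by rewrite ltr0n fact_gt0.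
(* The term e comes from the expansion on [0, +oo[ and e^8 from the part on ]-oo, 0]; both bounds
   carry 3^{n+1}, whence the division by 3. *)
have -> : (expR 1 + expR 8) / 3 * (1 / 3 ^+ n) =
    (expR 1 + expR 8) / 3 ^+ n.+1 :> R by rewrite exprS invfM; ring.
rewrite -(ler_pM2l f0) -{1}(gtr0_norm f0) -normrM.
have := gumbel_moment_0y n; have := gompertz_moment_le n.
rewrite euler_mascheroni_split; set A := (X in X + _).
set J := gompertz_moment n.
move=> leJ leA.
have -> : n`!%:R * ((A + (-1) ^+ n * J) / n`!%:R - (1 - 1 / 2 ^+ n.+1)) =
    A - n`!%:R * (1 - 1 / 2 ^+ n.+1) + (-1) ^+ n * J.
  rewrite mulrBr mulrCA divff ?gt_eqF// mulr1; ring.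
apply: le_trans (ler_normD _ _) _.
have -> : `|(-1) ^+ n * J| = J.
  by rewrite normrM normrX normrN1 expr1n mul1r ger0_norm ?gompertz_moment_ge0.
apply: le_trans (lerD leA leJ) _.
by rewrite -mulrDl mulrCA.
Qed.

End gumbel_moments.

(** * Existence and growth of the Lambert function *)

Section lambert.
Context {R : realType}.
Implicit Types (x w : R).

(** The intermediate value theorem for w e^w on [0, x] applies because x <= x e^x; the element that
    [xget] picks then satisfies the defining property. *)
Lemma lambertW_spec x : 0 < x ->
  0 < lambertW x /\ lambertW x * expR (lambertW x) = x.
Proof.
move=> x0; suff [w hw] : [set w : R | 0 < w /\ w * expR w = x] !=set0.
  exact: (@xgetPex _ 0 [set w : R | 0 < w /\ w * expR w = x] (ex_intro _ w hw)).
have [||w] := @IVT R (fun w => w * expR w) 0 x x (ltW x0).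
- apply: continuous_subspaceT => w.
  by apply: cvgM; [exact: cvg_id | exact: continuous_expR].
- rewrite mul0r; apply/andP; split; first by rewrite ge_min ltW.
  rewrite le_max; apply/orP; right.
  by rewrite ler_peMr ?ltW// -expR0 ltr_expR.
- rewrite in_itv/= => /andP[w0 _] wx; exists w; split => //.
  rewrite lt_neqAle w0 andbT; apply/eqP => w_eq0.
  by move: x0; rewrite -wx -w_eq0 mul0r ltxx.
Qed.

Lemma lambertW_gt0 x : 0 < x -> 0 < lambertW x.
Proof. by move=> /lambertW_spec[]. Qed.

Lemma lambertW_eq x : 0 < x -> lambertW x * expR (lambertW x) = x.
Proof. by move=> /lambertW_spec[]. Qed.

(** If W(n) < A, then n = W(n) e^{W(n)} < A e^A, which fails for large n. *)
Lemma cvg_lambertW : lambertW (n%:R : R) @[n --> \oo] --> +oo.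
Proof.
apply/cvgryPge => A.
near=> n.
rewrite leNgt; apply/negP => WA.
have n0 : 0 < n%:R :> R by near: n; exact: (nbhs_infty_gtr 0).
have W0 := lambertW_gt0 _ n0.
have : n%:R < A * expR A :> R.
  rewrite -[ltLHS](lambertW_eq _ n0).
  by apply: ltr_pM; rewrite ?ltW// ?expR_gt0// ?ltr_expR.
apply/negP; rewrite -leNgt; near: n; exact: nbhs_infty_ger.
Unshelve. all: by end_near. Qed.

End lambert.

(** * Bounds on the rescaled integrand of the Laplace method *)

Section laplace.
Context {R : realType}.
Implicit Types (s t u w x y : R) (n : nat).
Local Notation mu := (@lebesgue_measure R).

(* The tangent line at ln (1 + t), with ln (1 + t) replaced by t. *)
Lemma expR_sub1_ge x t : -1 < t -> t * x - t ^+ 2 <= expR x - 1 - x.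
Proof.
(* The product expands to 1 + x + t x - t^2; its factors are lower bounds for those of e^x = e^{x-t}
   e^t. If 1 + x - t is negative, so is the product. *)
move=> t1; suff : (1 + x - t) * (1 + t) <= expR x by nra.
have [xt|xt] := leP 0 (1 + x - t); last first.
  by apply: le_trans (expR_ge0 x); nra.
have -> : expR x = expR (x - t) * expR t by rewrite -expRD subrK.
have := expR_ge1Dx (x - t); have := expR_ge1Dx t; nra.
Qed.

Lemma bernoulli_le t n : 0 <= t <= 1 -> 1 - n%:R * t <= (1 - t) ^+ n.
Proof.
move=> /andP[t0 t1]; elim: n => [|n ih]; first by rewrite mul0r subr0.
rewrite exprS; apply: le_trans (_ : (1 - t) * (1 - n%:R * t) <= _); last first.
  by rewrite ler_wpM2l// subr_ge0.
rewrite -natr1; have : 0 <= n%:R * t ^+ 2 by rewrite mulr_ge0 ?sqr_ge0.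
nra.
Qed.

(* Up to a constant factor, y^n exp(y - e^y) at y = w + s u; the maximum extends
   it by 0 to y < 0, which keeps it continuous when n > 0. *)
Definition laplace_integrand n w s u : R :=
  Num.max 0 (1 + s * u / w) ^+ n *
  (expR (s * u) * expR (- (expR w * (expR (s * u) - 1)))).

Lemma laplace_integrand_ge0 n w s u : 0 <= laplace_integrand n w s u.
Proof. by rewrite !mulr_ge0 ?expR_ge0 ?exprn_ge0// le_max lexx. Qed.

(** The relation n = w e^w makes w critical for n ln y - e^y: the linear terms of the two parts
    cancel, leaving (1 + t) e^{-t} with t = s u / w and e^x - 1 - x with x = s u. *)
Lemma laplace_integrandE n w s u : w != 0 -> n%:R = w * expR w ->
  laplace_integrand n w s u =
  (Num.max 0 (1 + s * u / w) * expR (- (s * u / w))) ^+ n *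
  (expR (s * u) * expR (- (expR w * (expR (s * u) - 1 - s * u)))).
Proof.
move=> w0 nw; rewrite exprMn -expRM_natl nw -[RHS]mulrA; congr (_ * _).
rewrite [RHS]mulrCA -[in RHS]expRD; congr (_ * expR _); field.
exact: w0.
Qed.

Lemma laplace_factor_le1 t : Num.max 0 (1 + t) * expR (- t) <= 1.
Proof.
rewrite expRN ler_pdivrMr ?expR_gt0// mul1r ge_max expR_ge0/=.
exact: expR_ge1Dx.
Qed.

Lemma laplace_integrand_le n w s u : n%:R = w * expR w ->
  expR w * s ^+ 2 = w / (w + 1) -> 1 <= w -> 0 < s -> s <= 1 / 4 ->
  laplace_integrand n w s u <= expR (4 - `|u| / 2).
Proof.
move=> nw sw w1 s0 s4; have w0 : 0 < w by exact: lt_le_trans w1.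
rewrite laplace_integrandE ?gt_eqF//.
apply: (@le_trans _ _ (1 * (expR (s * u) *
    expR (- (expR w * (expR (s * u) - 1 - s * u)))))).
  rewrite ler_wpM2r ?mulr_ge0 ?expR_ge0//.
  rewrite exprn_ile1 ?laplace_factor_le1//.
  by rewrite mulr_ge0 ?expR_ge0// le_max lexx.
rewrite mul1r -expRD ler_expR.
(* Put b = e^w s^2 = w / (w + 1). The bound b <= 1 gives the constant 4 and b >= 1/2 the linear
   decay, of which e^{su} costs at most u/4 when u >= 0 because s <= 1/4. *)
have b1 : w / (w + 1) <= 1 by rewrite ler_pdivrMr ?mul1r; lra.
have b2 : 1 / 2 <= w / (w + 1) by rewrite ler_pdivlMr; lra.
move: b1 b2; rewrite -sw => b1 b2.
(* The quadratic coming from (1 + t)^n e^{-nt} degenerates as w grows, so all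
   the decay is taken from e^x - 1 - x, bounded below linearly with t = +-2s. *)
have [u0|u0] := leP 0 u.
  rewrite ger0_norm//.
  have /(ler_wpM2l (expR_ge0 w)) : 2 * s * (s * u) - (2 * s) ^+ 2 <=
    expR (s * u) - 1 - s * u by apply: expR_sub1_ge; lra.
  have -> : expR w * (2 * s * (s * u) - (2 * s) ^+ 2) =
    (expR w * s ^+ 2) * (2 * u - 4) by ring.
  move: (expR w * s ^+ 2) (expR w * (_ - _)) b1 b2 => b E b1 b2 h.
  have : s * u <= 1 / 4 * u by rewrite ler_wpM2r.
  nra.
rewrite ltr0_norm//.
have /(ler_wpM2l (expR_ge0 w)) : (- 2 * s) * (s * u) - (- 2 * s) ^+ 2 <=
  expR (s * u) - 1 - s * u by apply: expR_sub1_ge; lra.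
have -> : expR w * ((- 2 * s) * (s * u) - (- 2 * s) ^+ 2) =
  (expR w * s ^+ 2) * (- 2 * u - 4) by ring.
move: (expR w * s ^+ 2) (expR w * (_ - _)) b1 b2 => b E b1 b2 h.
have : s * u <= 0 by rewrite pmulr_rle0// ltW.
nra.
Qed.

(** With t = s u / w, (1 + t) e^{-t} >= 1 - t^2, and Bernoulli's inequality gives 1 - n t^2, where n
    t^2 = u^2 / (w + 1). *)
Lemma laplace_factor_ge n w s u : n%:R = w * expR w ->
  expR w * s ^+ 2 = w / (w + 1) -> 0 < w -> (0 < n)%N -> u ^+ 2 <= w + 1 ->
  1 - u ^+ 2 / (w + 1) <=
  (Num.max 0 (1 + s * u / w) * expR (- (s * u / w))) ^+ n.
Proof.
move=> nw sw w0 n0 uw; set t := s * u / w.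
have w10 : 0 < w + 1 by lra.
have nt : n%:R * t ^+ 2 = u ^+ 2 / (w + 1).
  rewrite nw /t; transitivity ((expR w * s ^+ 2) * u ^+ 2 / w).
    by field; rewrite gt_eqF.
  by rewrite sw; field; rewrite ?gt_eqF.
(* From n t^2 <= 1 and n >= 1; hence 1 + t >= 0 and the maximum with 0 is 1 + t. *)
have t21 : t ^+ 2 <= 1.
  apply: (@le_trans _ _ (n%:R * t ^+ 2)).
    by rewrite ler_peMl ?sqr_ge0// ler1n.
  by rewrite nt ler_pdivrMr// mul1r.
have t1 : -1 <= t <= 1 by rewrite -ler_norml -sqrtr_sqr -sqrtr1 ler_sqrt.
rewrite -nt; apply: le_trans (bernoulli_le _ _ _) _.
  by rewrite sqr_ge0.
apply: lerXn2r; rewrite ?nnegrE ?subr_ge0//.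
  by rewrite mulr_ge0 ?expR_ge0// le_max lexx.
rewrite (max_idPr _); last by lra.
have := expR_ge1Dx (- t); nra.
Qed.

End laplace.

(** * Pointwise Gaussian limit and the change of variables *)

Section laplace_limit.
Context {R : realType}.
Implicit Types (s t u w x y : R) (n : nat).
Local Notation mu := (@lebesgue_measure R).

Lemma cvg_invrD1 (w : nat -> R) : w n @[n --> \oo] --> +oo ->
  (w n + 1)^-1 @[n --> \oo] --> (0 : R).
Proof.
move=> cw; apply/gtr0_cvgV0.
  by near=> n; rewrite ltr_wpDr//; near: n; exact: cvgry_gt.
apply/cvgryPge => A; near=> n.
by rewrite -lerBlDr; near: n; exact: cvgry_ge.
Unshelve. all: by end_near. Qed.

(** Second-order Taylor expansion: the quadratic term is (w / (w + 1)) u^2 / 2, and the cubic error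
    e^w e |s u|^3 is at most e |u|^3 s, since e^w s^2 <= 1. *)
Lemma gompertz_exponent_cvg (w s : nat -> R) u :
  (\forall n \near \oo, expR (w n) * s n ^+ 2 = w n / (w n + 1) /\
    0 < w n /\ 0 < s n) ->
  w n @[n --> \oo] --> +oo -> s n @[n --> \oo] --> 0 ->
  expR (w n) * (expR (s n * u) - 1 - s n * u) @[n --> \oo] --> u ^+ 2 / 2.
Proof.
move=> Hws cw cs.
have cb : 1 - (w n + 1)^-1 @[n --> \oo] --> (1 : R).
  rewrite -[X in _ --> X]subr0; apply: cvgB; first exact: cvg_cst.
  exact: cvg_invrD1.
pose C := expR 1 * `|u| ^+ 3.
have cM (c : R) : (1 - (w n + 1)^-1) * (u ^+ 2 / 2) + c * s n
    @[n --> \oo] --> u ^+ 2 / 2.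
  rewrite -[X in _ --> X]addr0 -[X in _ --> X + _]mul1r -(mulr0 c).
  apply: cvgD; apply: cvgM => //; exact: cvg_cst.
apply: (squeeze_cvgr _ (cM (- C)) (cM C)).
near=> n.
have [sw [w0 s0]] : expR (w n) * s n ^+ 2 = w n / (w n + 1) /\
    0 < w n /\ 0 < s n by near: n.
have su1 : `|s n * u| <= 1.
  near: n; apply: cvgr0_norm_le; last exact: ltr01.
  by rewrite -(mul0r u); apply: cvgM => //; exact: cvg_cst.
have w10 : 0 < w n + 1 by lra.
have bE : w n / (w n + 1) = 1 - (w n + 1)^-1 by field; rewrite gt_eqF.
rewrite mulNr -ler_distlC.
have := normr_expR_sub2_le _ su1.
move=> /(ler_wpM2l (expR_ge0 (w n))).
rewrite -{1}(ger0_norm (expR_ge0 (w n))) -normrM -bE -sw => h.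
rewrite distrC (_ : expR (w n) * _ - _ = expR (w n) *
  (expR (s n * u) - (1 + s n * u + (s n * u) ^+ 2 / 2))); last by ring.
apply: le_trans h _.
rewrite normrM (gtr0_norm s0).
rewrite (_ : expR (w n) * _ = (expR (w n) * s n ^+ 2) * (C * s n)); last first.
  by rewrite /C; ring.
rewrite sw; apply: ler_piMl.
  by rewrite !mulr_ge0 ?expR_ge0 ?exprn_ge0// ltW.
by rewrite ler_pdivrMr// mul1r lerDl.
Unshelve. all: by end_near. Qed.

(** The Gaussian comes from the double exponential alone: the n-th power is squeezed between 1 - u^2
    / (w + 1) and 1, and e^{su} tends to 1. *)
Lemma laplace_integrand_cvg (w s : nat -> R) u :
  (\forall n \near \oo, n%:R = w n * expR (w n) /\
    expR (w n) * s n ^+ 2 = w n / (w n + 1) /\ 0 < w n /\ 0 < s n) ->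
  w n @[n --> \oo] --> +oo -> s n @[n --> \oo] --> 0 ->
  laplace_integrand n (w n) (s n) u @[n --> \oo] --> expR (- (u ^+ 2 / 2)).
Proof.
move=> Hws cw cs.
have cF1 : (Num.max 0 (1 + s n * u / w n) * expR (- (s n * u / w n))) ^+ n
    @[n --> \oo] --> (1 : R).
  apply: (@squeeze_cvgr _ _ _ _ (fun n => 1 - u ^+ 2 / (w n + 1)) (cst 1)).
  - near=> n; apply/andP; split.
      have [nw [sw [w0 s0]]] : n%:R = w n * expR (w n) /\
        expR (w n) * s n ^+ 2 = w n / (w n + 1) /\ 0 < w n /\ 0 < s n by near: n.
      apply: laplace_factor_ge => //; first by near: n; exact: nbhs_infty_gt.
      rewrite -lerBlDr; near: n; exact: cvgry_ge.
    rewrite exprn_ile1 ?laplace_factor_le1//.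
    by rewrite mulr_ge0 ?expR_ge0// le_max lexx.
  - rewrite -[X in _ --> X]subr0 -(mulr0 (u ^+ 2)).
    apply: cvgB; first exact: cvg_cst.
    apply: cvgM; first exact: cvg_cst.
    exact: cvg_invrD1.
  - exact: cvg_cst.
have cF2 : expR (s n * u) @[n --> \oo] --> (1 : R).
  rewrite -expR0 -(mul0r u).
  apply: continuous_cvg; first exact: continuous_expR.
  by apply: cvgM => //; exact: cvg_cst.
have cF3 : expR (- (expR (w n) * (expR (s n * u) - 1 - s n * u)))
    @[n --> \oo] --> expR (- (u ^+ 2 / 2)).
  apply: continuous_cvg; first exact: continuous_expR.
  apply: cvgN; apply: gompertz_exponent_cvg => //.
  by near=> n; have [] : n%:R = w n * expR (w n) /\
    expR (w n) * s n ^+ 2 = w n / (w n + 1) /\ 0 < w n /\ 0 < s n by near: n.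
have cF := cvgM cF1 (cvgM cF2 cF3); rewrite !mul1r in cF.
apply: cvg_trans (cF _ _); apply: near_eq_cvg; near=> n.
have [nw [sw [w0 s0]]] : n%:R = w n * expR (w n) /\
  expR (w n) * s n ^+ 2 = w n / (w n + 1) /\ 0 < w n /\ 0 < s n by near: n.
by rewrite laplace_integrandE// gt_eqF.
Unshelve. all: by end_near. Qed.

Lemma continuous_affine s w : continuous (fun u : R => s * u + w).
Proof.
move=> u; apply: cvgD; last exact: cvg_cst.
by apply: cvgM; [exact: cvg_cst | exact: cvg_id].
Qed.

Lemma continuous_max0X n :
  continuous (fun x => Num.max 0 x ^+ n).
Proof.
move=> x; apply: (continuous_comp (f := fun y : R => Num.max 0 y)
  (g := fun y : R => y ^+ n)).
  apply: continuous_max; first exact: cvg_cst.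
  exact: cvg_id.
exact: exprn_continuous.
Qed.

Lemma continuous_max0_gompertz n :
  continuous (fun y => Num.max 0 y ^+ n * expR (y - expR y)).
Proof.
move=> y; apply: cvgM; first exact: continuous_max0X.
by have := continuous_gompertz 0 y; under eq_fun do rewrite expr0 mul1r.
Qed.

(** Passing to the whole line lets the affine substitution act without moving an endpoint; the
    extension vanishes on y < 0 because 0^n = 0 for n > 0. *)
Lemma integral_max0_gompertz n : (0 < n)%N ->
  (\int[mu]_y (Num.max 0 y ^+ n * expR (y - expR y))%:E =
   (gompertz_moment n)%:E)%E.
Proof.
move=> n0; rewrite /gompertz_moment /Rintegral fineK; last first.
  by apply: integrable_fin_num => //; exact: integrable_gompertz.
rewrite [RHS]integral_mkcond; apply: eq_integral => y _.
rewrite patchE; case: ifPn; rewrite ?inE ?notin_setE/= in_itv/= andbT => y0.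
  by rewrite (max_idPr _).
move/negP : y0; rewrite -ltNge => y0.
by rewrite (max_idPl _) ?ltW// expr0n gtn_eqF// mul0r.
Qed.

Lemma laplace_integrand_rescale n w s u : 0 < w ->
  w ^+ n * expR (w - expR w) * laplace_integrand n w s u =
  Num.max 0 (s * u + w) ^+ n * expR ((s * u + w) - expR (s * u + w)).
Proof.
move=> w0.
have -> : Num.max 0 (s * u + w) = w * Num.max 0 (1 + s * u / w).
  rewrite maxr_pMr ?ltW// mulr0; congr Num.max; field.
  by rewrite gt_eqF.
rewrite exprMn /laplace_integrand mulrACA -!mulrA; congr (_ * (_ * _)).
by rewrite -!expRD; congr expR; rewrite expRD; ring.
Qed.

Lemma integral_laplace_integrand n w s : (0 < n)%N -> 0 < w -> 0 < s ->
  (\int[mu]_u (laplace_integrand n w s u)%:E =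
   (gompertz_moment n / (s * w ^+ n * expR (w - expR w)))%:E)%E.
Proof.
move=> n0 w0 s0.
pose F u := s * u + w.
have dF (u : R) : is_derive u 1 F s.
  rewrite (_ : F = s *: (@id R) + cst w); last exact/funext.
  by apply: is_derive_eq; rewrite /GRing.scale/= mulr1 addr0.
have F'E : F^`()%classic = cst s.
  by apply/funext => u; rewrite derive1E derive_val.
have c0 : s * w ^+ n * expR (w - expR w) != 0.
  by rewrite !mulf_neq0 ?expf_neq0 ?gt_eqF ?expR_gt0.
rewrite mulrC EFinM -integral_max0_gompertz//.
rewrite (@increasing_ge0_integration_by_substitutionT R F
  (fun y => Num.max 0 y ^+ n * expR (y - expR y))).
- rewrite -ge0_integralZl//.
  + apply: eq_integral => u _; rewrite -EFinM; congr EFin.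
    rewrite F'E !fctE /F -laplace_integrand_rescale//.
    move: (laplace_integrand n w s u) c0 => L c0; field.
    move: c0; rewrite !mulf_eq0 !negb_or => /andP[/andP[-> ->] ->].
    by [].
  + apply/measurable_EFinP; rewrite F'E; apply: measurable_funM => //.
    apply: continuous_measurable_fun => u.
    apply: (continuous_comp (f := F)); first exact: continuous_affine.
    exact: continuous_max0_gompertz.
  + move=> u _; rewrite F'E lee_fin !fctE.
    by rewrite !mulr_ge0 ?expR_ge0 ?exprn_ge0 ?(ltW s0)// le_max lexx.
  + rewrite lee_fin invr_ge0 !mulr_ge0 ?expR_ge0 ?exprn_ge0 ?ltW//.
- by move=> x y xy; rewrite /F ltrD2r ltr_pM2l.
- by rewrite F'E => u; exact: cvg_cst.
- by rewrite F'E; exact: is_cvg_cst.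
- by rewrite F'E; exact: is_cvg_cst.
- by move=> u; have [] := dF u.
- apply: (cvg_comp (fun u : R => s * u) (fun v => v + w)
    _ (cvg_addrr_Ny w)).
  by apply: gt0_cvgMrNy => //; exact: cvg_id.
- apply: (cvg_comp (fun u : R => s * u) (fun v => v + w) _ (cvg_addrr w)).
  by apply: gt0_cvgMry => //; exact: cvg_id.
- exact: continuous_max0_gompertz.
- move=> y; rewrite mulr_ge0 ?expR_ge0 ?exprn_ge0//.
  by rewrite le_max lexx.
Qed.

End laplace_limit.

(** * Dominated convergence and the asymptotics of the Euler-Gompertz constants *)

Section gompertz_asymptotics.
Context {R : realType}.
Implicit Types (s t u w x y : R) (n : nat).
Local Notation mu := (@lebesgue_measure R).

(** Read off from the total mass 1 of the standard normal density. *)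
Lemma integral_expR_sqr2 :
  (\int[mu]_u (expR (- (u ^+ 2 / 2)))%:E = (Num.sqrt (2 * pi))%:E)%E.
Proof.
have p0 : 0 < Num.sqrt (2 * pi) :> R by rewrite sqrtr_gt0 mulr_gt0 ?pi_gt0.
transitivity (\int[mu]_u
    ((Num.sqrt (2 * pi))%:E * (normal_pdf 0 1 u)%:E))%E.
  apply: eq_integral => u _; rewrite -EFinM; congr EFin.
  rewrite normal_pdfE ?oner_neq0// /normal_peak /normal_fun.
  rewrite subr0 expr1n mul1r -(mulr_natl pi).
  by rewrite mulrA divff ?gt_eqF// mul1r mulNr.
rewrite ge0_integralZl//.
- by rewrite integral_normal_pdf mule1.
- by apply/measurable_EFinP; exact: measurable_normal_pdf.
- by move=> u _; rewrite lee_fin normal_pdf_ge0.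
Qed.

(** This is the dominating function; evenness reduces it to the exponential moment of order 0 at
    rate 1/2. *)
Lemma integrable_expR_abs :
  mu.-integrable setT (fun u : R => (expR (4 - `|u| / 2))%:E).
Proof.
have cf : continuous (fun u : R => expR (4 - `|u| / 2)).
  move=> u; apply: continuous_comp; last exact: continuous_expR.
  apply: cvgB; first exact: cvg_cst.
  by apply: cvgM; [exact: norm_continuous | exact: cvg_cst].
apply/integrableP; split.
  by apply/measurable_EFinP; exact: continuous_measurable_fun.
under eq_integral do rewrite /= ger0_norm ?expR_ge0//.
rewrite ge0_symfun_integralT//; last by move=> u /=; rewrite normrN.
rewrite -set_itvcy.
rewrite (_ : \int[mu]_(x in `[0%R, +oo[) _ =
    \int[mu]_(x in `[0%R, +oo[)
      ((expR 4)%:E * (x ^+ 0 * expR (- (1 / 2) * x))%:E))%E; last first.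
  apply: eq_integral => u; rewrite inE/= in_itv/= andbT => u0.
  rewrite -EFinM expr0 mul1r -expRD ger0_norm//; congr (expR _)%:E; ring.
rewrite ge0_integralZl//.
- by rewrite integral_powexp ?divr_gt0// -!EFinM ltry.
- by apply/measurable_EFinP; exact: measurable_fun_powexp.
- by move=> u _; rewrite lee_fin expr0 mul1r expR_ge0.
Qed.

Lemma measurable_laplace_integrand n w s :
  measurable_fun setT (laplace_integrand n w s).
Proof.
apply: continuous_measurable_fun => u.
have c1 : continuous (fun u : R => s * u) by exact: mulrl_continuous.
have c2 : continuous (fun u : R => expR (s * u)).
  move=> v; apply: (continuous_comp (f := fun u : R => s * u) (g := expR)).
    exact: c1.
  exact: continuous_expR.
apply: cvgM.
  apply: (continuous_comp (f := fun u : R => 1 + s * u / w)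
    (g := fun x : R => Num.max 0 x ^+ n)); last exact: continuous_max0X.
  apply: cvgD; first exact: cvg_cst.
  by apply: cvgM; [exact: c1 | exact: cvg_cst].
apply: cvgM; first exact: c2.
apply: continuous_comp; last exact: continuous_expR.
apply: cvgN; apply: cvgM; first exact: cvg_cst.
by apply: cvgB; [exact: c2 | exact: cvg_cst].
Qed.

(* - 1 / (laplace_width w)^2 is the second derivative of n ln y - e^y at y = w
   when n = w e^w. *)
Definition laplace_width w := Num.sqrt (w / ((w + 1) * expR w)).

Lemma laplace_width_gt0 w : 0 < w -> 0 < laplace_width w.
Proof.
by move=> w0; rewrite sqrtr_gt0 divr_gt0// mulr_gt0 ?expR_gt0// addr_gt0.
Qed.

Lemma laplace_width_sqr w : 0 < w ->
  expR w * laplace_width w ^+ 2 = w / (w + 1).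
Proof.
move=> w0; have e0 := expR_gt0 w.
rewrite sqr_sqrtr ?divr_ge0 ?mulr_ge0 ?addr_ge0 ?expR_ge0 ?ltW//.
by field; rewrite !gt_eqF// addr_gt0.
Qed.

Lemma laplace_width_cvg (w : nat -> R) : w n @[n --> \oo] --> +oo ->
  laplace_width (w n) @[n --> \oo] --> 0.
Proof.
move=> cw; rewrite -sqrtr0.
apply: continuous_cvg; first exact: sqrt_continuous.
(* The square of the width is at most 1 / (w + 1), since w <= e^w. *)
apply: (squeeze_cvgr _ (cvg_cst 0) (cvg_invrD1 w cw)); near=> n.
have w0 : 0 < w n by near: n; exact: cvgry_gt.
have w1 : 0 < w n + 1 by rewrite addr_gt0.
have e0 := expR_gt0 (w n).
apply/andP; split.
  by rewrite divr_ge0 ?mulr_ge0 ?ltW.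
rewrite invfM mulrCA ler_piMr ?invr_ge0 ?(ltW w1)//.
rewrite ler_pdivrMr// mul1r; apply: le_trans (expR_ge1Dx _).
by rewrite lerDr.
Unshelve. all: by end_near. Qed.

Let W n : R := lambertW n%:R.
Let sg n : R := laplace_width (W n).

Let W_eq n : (0 < n)%N -> n%:R = W n * expR (W n).
Proof. by move=> n0; rewrite lambertW_eq// ltr0n. Qed.

Let W_gt0 n : (0 < n)%N -> 0 < W n.
Proof. by move=> n0; rewrite lambertW_gt0// ltr0n. Qed.

Let cvgW : W n @[n --> \oo] --> +oo. Proof. exact: cvg_lambertW. Qed.

Let cvgsg : sg n @[n --> \oo] --> 0. Proof. exact: laplace_width_cvg. Qed.

Lemma cvg_integral_laplace_integrand :
  (\int[mu]_u (laplace_integrand n (W n) (sg n) u)%:E @[n --> \oo] -->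
   (Num.sqrt (2 * pi))%:E)%E.
Proof.
have [N _ HN] : \forall n \near \oo, [/\ (0 < n)%N, 1 <= W n & sg n <= 1 / 4].
  near=> n; split.
  - by near: n; exact: nbhs_infty_gt.
  - by near: n; exact: cvgry_ge.
  - apply: le_trans (ler_norm _) _; near: n.
    by apply: cvgr0_norm_le => //; rewrite divr_gt0.
(* The domination holds only from rank N on, while [dominated_cvg] asks for it at every index, so
   the sequence is shifted. *)
rewrite -integral_expR_sqr2 -(cvg_shiftn N).
apply: (dominated_cvg _ _ _ _ integrable_expR_abs) => //.
- move=> n; apply/measurable_EFinP; exact: measurable_laplace_integrand.
- move=> u _; apply: cvg_EFin; first exact: nearW.
  rewrite (cvg_shiftn N
    (fun n => laplace_integrand n (W n) (sg n) u) (nbhs (expR (- (u ^+ 2 / 2))))).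
  apply: laplace_integrand_cvg => //.
  near=> n.
  have n0 : (0 < n)%N by near: n; exact: nbhs_infty_gt.
  by rewrite W_eq// laplace_width_sqr ?W_gt0// laplace_width_gt0 ?W_gt0.
- move=> n u _ /=; have [n0 W1 s4] := HN (n + N)%N (leq_addl _ _).
  rewrite lee_fin ger0_norm ?laplace_integrand_ge0//.
  apply: laplace_integrand_le => //; first exact: W_eq.
    by rewrite laplace_width_sqr ?W_gt0.
  by rewrite laplace_width_gt0 ?W_gt0.
Unshelve. all: by end_near. Qed.

Lemma cvg_gompertz_moment :
  gompertz_moment n / (sg n * W n ^+ n * expR (W n - expR (W n)))
    @[n --> \oo] --> Num.sqrt (2 * pi).
Proof.
have h : \forall n \near \oo,
    (\int[mu]_u (laplace_integrand n (W n) (sg n) u)%:E =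
    (gompertz_moment n /
      (sg n * W n ^+ n * expR (W n - expR (W n))))%:E)%E.
  near=> n.
  have n0 : (0 < n)%N by near: n; exact: nbhs_infty_gt.
  by apply: integral_laplace_integrand; rewrite ?laplace_width_gt0 ?W_gt0.
have c : (gompertz_moment n /
      (sg n * W n ^+ n * expR (W n - expR (W n))))%:E @[n --> \oo] -->
   (Num.sqrt (2 * pi))%:E.
  apply: cvg_trans cvg_integral_laplace_integrand.
  by apply: near_eq_cvg; near=> n; near: n.
by have /fine_cvgP[] := c.
Unshelve. all: by end_near. Qed.

(** Since n / W = e^W and e^W sg^2 = W / (W + 1), the quotient n / (W + 1) is the square of sg
    e^W. *)
Lemma gompertz_main_termE n : (0 < n)%N ->
  expR 1 * W n ^+ n * expR (- (n%:R / W n)) *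
    Num.sqrt (2 * pi * n%:R / (W n + 1)) =
  expR 1 * (sg n * W n ^+ n * expR (W n - expR (W n))) * Num.sqrt (2 * pi).
Proof.
move=> n0; have W0 := W_gt0 _ n0; have e0 := expR_gt0 (W n).
have s0 : 0 < sg n by exact: laplace_width_gt0.
have -> : n%:R / W n = expR (W n).
  by rewrite {1}(W_eq _ n0); field; rewrite gt_eqF.
rewrite (_ : 2 * pi * n%:R / (W n + 1) = 2 * pi * (sg n * expR (W n)) ^+ 2).
  rewrite sqrtrM ?mulr_ge0 ?pi_ge0// sqrtr_sqr ger0_norm; last first.
    by rewrite mulr_ge0 ?ltW.
  by rewrite expRD; ring.
have := laplace_width_sqr _ W0; rewrite -/(sg n) => sE.
transitivity (2 * pi * (expR (W n) * (expR (W n) * sg n ^+ 2))); last by ring.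
by rewrite sE (W_eq _ n0); ring.
Qed.

Lemma euler_gompertz_asymptotics :
  exists2 r : nat -> R, r =o_\oo (fun _ : nat => 1 : R) &
  forall n, (0 < n)%N ->
    `|euler_gompertz R n| =
    expR 1 * W n ^+ n * expR (- (n%:R / W n)) *
    Num.sqrt (2 * pi * n%:R / (W n + 1)) * (1 + r n).
Proof.
have p0 : 0 < Num.sqrt (2 * pi) :> R by rewrite sqrtr_gt0 mulr_gt0 ?pi_gt0.
pose c n := sg n * W n ^+ n * expR (W n - expR (W n)).
(* The exact relative error, so the identity for n > 0 is pure cancellation and only the limit 0
   needs the analysis. *)
exists (fun n => gompertz_moment n / c n / Num.sqrt (2 * pi) - 1).
  have cr : gompertz_moment n / c n / Num.sqrt (2 * pi) - 1 @[n --> \oo] --> 0.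
    rewrite -[X in _ --> X](subrr (1 : R)).
    rewrite -[X in _ --> X - _](divff (lt0r_neq0 p0)).
    apply: cvgB; last exact: cvg_cst.
    by apply: cvgM; [exact: cvg_gompertz_moment | exact: cvg_cst].
  apply/eqoP => e e0; rewrite normr1 mulr1.
  exact: cvgr0_norm_le.
move=> n n0; rewrite gompertz_main_termE// normr_euler_gompertz -/(c n).
have c0 : c n != 0.
  by rewrite gt_eqF// !mulr_gt0 ?exprn_gt0 ?expR_gt0 ?laplace_width_gt0 ?W_gt0.
rewrite addrC subrK; move: (lt0r_neq0 p0) c0.
move: (Num.sqrt _) (c n) (gompertz_moment n) => p k J p1 k0.
by field; rewrite p1 k0.
Qed.

End gompertz_asymptotics.

(** * Assembly of the three estimates *)

Lemma eqO_inv_exp3 {R : realType} (r : nat -> R) (C : R) : 0 < C ->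
  (forall n, (0 < n)%N -> `|r n| <= C * (1 / 3 ^+ n)) ->
  r =O_\oo (fun n => 1 / 3 ^+ n : R).
Proof.
move=> C0 rC; apply/eqO_exP; exists C => //; near=> n.
rewrite (ger0_norm (_ : 0 <= 1 / 3 ^+ n)) ?divr_ge0 ?exprn_ge0//.
by apply: rC; near: n; exact: nbhs_infty_gt.
Unshelve. all: by end_near. Qed.

Theorem proposition1 (R : realType) :
  (exists2 r : nat -> R, r =O_\oo (fun n : nat => 1 / 3 ^+ n : R) &
     forall n : nat, (0 < n)%N ->
       euler_mascheroni R n = (n`!)%:R * (1 - 1 / 2 ^+ n.+1 + r n)) /\
  (exists2 s : nat -> R, s =o_\oo (fun _ : nat => 1 : R) &
     forall n : nat, (0 < n)%N ->
       let W := lambertW (n%:R : R) in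
       `|euler_gompertz R n| =
       expR 1 * W ^+ n * expR (- (n%:R / W)) *
       Num.sqrt (2 * pi * n%:R / (W + 1)) * (1 + s n)) /\
  (exists2 t : nat -> R, t =O_\oo (fun n : nat => 1 / 3 ^+ n : R) &
     forall n : nat, (0 < n)%N ->
       eta_const R n = (n`!)%:R * (1 - 1 / 2 ^+ n.+1 + t n)).
Proof.
have fact0 n : n`!%:R != 0 :> R by rewrite pnatr_eq0 gtn_eqF ?fact_gt0.
split; last split.
- exists (fun n => euler_mascheroni R n / n`!%:R - (1 - 1 / 2 ^+ n.+1)).
    apply: (eqO_inv_exp3 _ ((expR 1 + expR 8) / 3)).
      by rewrite divr_gt0// addr_gt0 ?expR_gt0.
    by move=> n _; exact: euler_mascheroni_bound.
  by move=> n _; rewrite addrC subrK mulrC divfK.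
- exact: euler_gompertz_asymptotics.
- exists (fun n => eta_const R n / n`!%:R - (1 - 1 / 2 ^+ n.+1)).
    apply: (eqO_inv_exp3 _ (expR 1)); first exact: expR_gt0.
    exact: eta_const_bound.
  by move=> n _; rewrite addrC subrK mulrC divfK.
Qed.
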